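(* Let $\alpha=(\alpha_1,\dots,\alpha_\ell)$ and $\beta=(\beta_1,\dots,\beta_\ell)$ be compositions of the same length $\ell$, and put $\hat\alpha_i=\alpha_i-i$ and $\hat\beta_j=\beta_j-j$. Suppose that the expansion $\mathfrak{S}_{\alpha/\beta}=\sum_{\sigma\in S_\ell}\operatorname{sgn}(\sigma)\,H_{\hat\alpha_1-\hat\beta_{\sigma(1)}}H_{\hat\alpha_2-\hat\beta_{\sigma(2)}}\cdots H_{\hat\alpha_\ell-\hat\beta_{\sigma(\ell)}}$ contains at least one nonzero term before cancellation, i.e. there is a permutation $\sigma\in S_\ell$ with $\hat\alpha_i-\hat\beta_{\sigma(i)}\ge 0$ for all $i$. Then for every $k$ with $1\le k\le \ell$, the number of indices $i\in\{1,\dots,\ell\}$ such that $\hat\alpha_i$ is smaller than at least $\ell-k+1$ of the entries of $\hat\beta$ (i.e. $|\{j:\hat\beta_j>\hat\alpha_i\}|\ge \ell-k+1$) is at most $k-1$.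
   Context: A composition is a finite sequence of positive integers. $\mathrm{NSym}$ is the free associative algebra over $\mathbb{R}$ generated by noncommuting symbols $H_1,H_2,\dots$, with the conventions $H_0=1$ and $H_a=0$ for $a<0$; for a composition $\gamma$, $H_\gamma=H_{\gamma_1}H_{\gamma_2}\cdots$, and these form a basis. For compositions $\alpha,\beta$ of length $\ell$, the associated matrix is $M_{\alpha/\beta}$ with $(M_{\alpha/\beta})_{i,j}=H_{(\alpha_i-i)-(\beta_j-j)}$, and the skew immaculate function is $\mathfrak{S}_{\alpha/\beta}=\operatorname{ndet}(M_{\alpha/\beta})$, the noncommutative determinant computed by Laplace expansion starting in the top row and proceeding sequentially to the bottom row; equivalently $\operatorname{ndet}(M)=\sum_{\sigma\in S_\ell}\operatorname{sgn}(\sigma)M_{1,\sigma(1)}\cdots M_{\ell,\sigma(\ell)}$. A term of this sum is ''nonzero before cancellation'' if all its factors have nonnegative subscripts. *)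

(* Defs.v *)
From mathcomp Require Import all_boot all_order all_fingroup all_algebra.
Set Implicit Arguments.
Unset Strict Implicit.
Unset Printing Implicit Defensive.
Import Order.TTheory GRing.Theory Num.Theory.
Local Open Scope ring_scope.

Definition is_composition (s : seq nat) : bool := all (fun a => (0 < a)%N) s.

(* Positions in a composition are numbered from 1 and ordinals from 0, hence
   the shift by i.+1. *)
Definition hat (l : nat) (a : l.-tuple nat) (i : 'I_l) : int :=
  (tnth a i)%:Z - (i.+1)%:Z.

(* The (i, j) entry of M_{a/b} is the generator H of NSym whose subscript is
   the (i, j) entry below. *)
Definition subscript_mx (l : nat) (a b : l.-tuple nat) : 'M[int]_l :=
  \matrix_(i, j) (hat a i - hat b j).

(* The subscripts, in order, of the word H_{c_1} ... H_{c_l} that is the term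
   of ndet M_{a/b} indexed by s (up to its sign). *)
Definition term_subscripts (l : nat) (a b : l.-tuple nat) (s : 'S_l) :
    l.-tuple int :=
  [tuple subscript_mx a b i (s i) | i < l].

(* H_c = 0 exactly when c < 0 (with H_0 = 1), so a term is nonzero before
   cancellation when no factor has a negative subscript. *)
Definition nonzero_before_cancellation (l : nat) (a b : l.-tuple nat)
    (s : 'S_l) : bool :=
  all (fun c : int => 0 <= c) (term_subscripts a b s).

(* Main.v *)
Require Import Defs.
From mathcomp Require Import all_boot all_order all_fingroup all_algebra.
Import Order.TTheory GRing.Theory Num.Theory.
Local Open Scope ring_scope.

(** A nonzero term is a permutation [s] with [hat beta (s i) <= hat alpha i]. For the counted [i],
    the indices [s i] are distinct and avoid the [l - k + 1] or more places where [hat beta] exceeds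
    the largest counted [hat alpha]. *)

(* Let [i0] maximise [f] over the counted set: [s] maps the whole counted set
   into the complement of [[set j | f i0 < g j]], which has at least [m]
   elements. *)
Lemma card_exceeded_by_many (disp : Order.disp_t) (T : orderType disp)
    (I : finType) (f g : I -> T) (s : {perm I}) (m : nat) :
    (forall i, g (s i) <= f i)%O ->
  (#|[set i | m <= #|[set j | (f i < g j)%O]|]| <= #|I| - m)%N.
Proof.
move=> le_gf; set A := [set i | _].
have [-> | [i1 Ai1]] := set_0Vmem A; first by rewrite cards0.
case: (@arg_maxP _ _ _ i1 [in A] f Ai1) => i0 Ai0 max_i0.
set B := [set j | (f i0 < g j)%O].
have mB : (m <= #|B|)%N by rewrite inE in Ai0.
apply: leq_trans (leq_sub2l _ mB).
(* The bound [#|I| - #|B|] becomes [#|~: B|]; injectivity of [s] replaces [A] by its image. *)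
rewrite -[B]setCK -cardsCs -(card_imset A (@perm_inj _ s)).
apply/subset_leq_card/subsetP => _ /imsetP[i Ai ->].
rewrite !inE -leNgt; exact: le_trans (le_gf i) (max_i0 i Ai).
Qed.

Theorem theorem2 (l : nat) (alpha beta : l.-tuple nat)
    (halpha : is_composition alpha) (hbeta : is_composition beta)
    (hterm : exists s : 'S_l, nonzero_before_cancellation alpha beta s)
    (k : nat) (hk : (1 <= k <= l)%N) :
  (#|[set i : 'I_l |
       (l - k + 1 <= #|[set j : 'I_l | (hat alpha i < hat beta j)%R]|)%N]|
     <= k - 1)%N.
Proof.
have [s /all_tnthP nz_s] := hterm; have /andP[_ le_kl] := hk.
have le_hat i : hat beta (s i) <= hat alpha i.
  by have := nz_s i; rewrite tnth_mktuple mxE subr_ge0.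
have := @card_exceeded_by_many _ _ _ _ _ s (l - k + 1) le_hat.
(* [l - (l - k + 1) = k - 1] in truncated subtraction, by [k <= l]. *)
by rewrite card_ord subnDA subKn.
Qed.
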